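(* Let $n=4m>1$ and let $H$ be an $n\times n$ $(\pm1)$-matrix whose defining row $H_1$ contains exactly two $1$-alternating sequences (i.e. $\alpha_1=2$). Then $H$ is not a circulant Hadamard matrix.
   Context: A Hadamard matrix is an $n\times n$ matrix with entries in $\{+1,-1\}$ whose rows are mutually orthogonal. It is circulant if, writing its first row (the defining row) as $H_1=(h_1,\ldots,h_n)$, its $i$-th row is $H_i=(h_{1-i+1},\ldots,h_{n-i+1})$ with subscripts taken modulo $n$. Regard $H_1$ as a circular (cyclic) sequence of $+1$'s and $-1$'s. A block is a maximal set of cyclically consecutive entries of $H_1$ that are all equal; its size is its number of entries. A $1$-alternating sequence is a maximal run of cyclically consecutive blocks all of size exactly $1$, and $\alpha_1$ denotes the number of such sequences. *)

(* Defs.v *)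
From HB Require Import structures.
From mathcomp Require Import all_boot all_order all_algebra.

Set Implicit Arguments.
Unset Strict Implicit.
Unset Printing Implicit Defensive.

Import Order.TTheory GRing.Theory Num.Theory.
Local Open Scope ring_scope.

Definition pm1_mx (m n : nat) (H : 'M[int]_(m, n)) : Prop :=
  forall i j, H i j = 1 \/ H i j = -1.

Definition hadamard (n : nat) (H : 'M[int]_n) : Prop :=
  pm1_mx H /\ (forall i j, i != j -> \sum_k H i k * H j k = 0).

Definition defining_row (p : nat) (H : 'M[int]_p.+1) : 'rV[int]_p.+1 :=
  row ord0 H.

(* [j - i] is the subtraction modulo p.+1 of 'I_p.+1. *)
Definition circulant (p : nat) (H : 'M[int]_p.+1) : Prop :=
  forall i j, H i j = defining_row H ord0 (j - i).

(* [A] is a nonempty set of consecutive elements for the successor map [f],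
   i.e. A = {x, f x, ..., f^(#|A| - 1) x} for some x. On a cycle, the whole
   cycle is such a set. *)
Definition consecutive (T : finType) (f : T -> T) (A : {set T}) : bool :=
  (A != set0) && [exists x, A == [set y in traject f x #|A|]].

Definition constant_on (n : nat) (h : 'rV[int]_n) (B : {set 'I_n}) : bool :=
  [forall x in B, forall y in B, h ord0 x == h ord0 y].

Definition is_block (n : nat) (h : 'rV[int]_n) (B : {set 'I_n}) : bool :=
  maxset (fun C : {set 'I_n} => consecutive (@ordS n) C && constant_on h C) B.

Definition blocks (n : nat) (h : 'rV[int]_n) : {set {set 'I_n}} :=
  [set B | is_block h B].

(* The block starting right after the last entry of [B]; when [B] is the whole
   circle, there is no other block and [B] follows itself. *)
Definition next_block (n : nat) (h : 'rV[int]_n) (B : {set 'I_n}) : {set 'I_n} :=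
  if [pick x in B | ordS x \notin B] is Some x then pblock (blocks h) (ordS x)
  else B.

Definition is_one_alternating (n : nat) (h : 'rV[int]_n)
    (S : {set {set 'I_n}}) : bool :=
  maxset (fun U : {set {set 'I_n}} =>
            consecutive (next_block h) U
            && (U \subset [set B in blocks h | #|B| == 1%N])) S.

Definition alpha1 (n : nat) (h : 'rV[int]_n) : nat :=
  #|[set S | is_one_alternating h S]|.

(* Main.v *)
(* A perfect sequence f of n signs has all its nontrivial periodic
   autocorrelations equal to zero. Each window (x, x, -x, x) of f marks the
   first block of a 1-alternating sequence, so there are at most alpha_1 = 2
   such windows. By the autocorrelations at lags 1, 2, 3 their number is
   (n - Q) / 8, where Q is the sum of the products
   q_j = f_j f_(j+1) f_(j+2) f_(j+3); hence Q >= n - 16. Since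
   q_j q_(j+1) = f_j f_(j+4) and x y >= x + y - 1 for signs x and y, the
   autocorrelation at lag 4 gives 0 >= 2 Q - n, so n <= 32. As n is the square
   of the sum of f, it is 4 or 16. For n = 4 the lags 1 and 2 leave a single
   block of size 1, so alpha_1 <= 1.

   No power of two n >= 16 is possible. Indeed g_i = (f_i - f_(i + n/2)) / 2 is
   an integer sequence with g_(i + n/2) = - g_i whose correlations over half a
   period are divisible by n / 4, hence by 4. Replacing g_i by g_i + g_(i+1)
   preserves these two properties, and n / 2 replacements make all entries even.
   If g were not even, the last sequence with an odd entry would be odd
   everywhere, since its consecutive sums are even; but then its correlation at
   lag 1 would be n / 2 - 2 modulo 4. So g is even, and being bounded by 1 it
   vanishes: f has period n / 2, which contradicts its autocorrelation at that
   lag. *)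
Require Import Defs.
From HB Require Import structures.
From mathcomp Require Import all_boot all_order all_algebra.
From mathcomp Require Import zify lra.

Set Implicit Arguments.
Unset Strict Implicit.
Unset Printing Implicit Defensive.

Import Order.TTheory GRing.Theory Num.Theory.
Local Open Scope ring_scope.

Lemma sum_shift (V : finZmodType) (M : nmodType) (k : V) (F : V -> M) :
  \sum_j F (j + k) = \sum_j F j.
Proof. by rewrite [RHS](reindex_inj (addIr k)). Qed.

Section Autocorrelation.

Variables (V : finZmodType) (R : pzRingType) (f : V -> R).

Definition autocorr (k : V) : R := \sum_j f j * f (j + k).

Definition sign_valued : Prop := forall j, f j = 1 \/ f j = -1.

Definition perfect : Prop := forall k, k != 0 -> autocorr k = 0.

Definition uncorrelated (u : V) (m : nat) : Prop :=
  forall k, (0 < k <= m)%N -> autocorr (u *+ k) = 0.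

Lemma autocorr_shift (a b : V) :
  \sum_j f (j + a) * f (j + b) = autocorr (b - a).
Proof.
rewrite /autocorr -[RHS](sum_shift a).
by apply: eq_bigr => j _; rewrite -addrA [a + _]addrC subrK.
Qed.

Lemma uncorrelated_shift (u : V) m k l : uncorrelated u m ->
  (k < l <= m)%N -> \sum_j f (j + u *+ k) * f (j + u *+ l) = 0.
Proof.
move=> unc /andP[ltkl lelm]; rewrite autocorr_shift -mulrnBr 1?ltnW //.
by apply: unc; rewrite subn_gt0 ltkl (leq_trans (leq_subr _ _)).
Qed.

Lemma sqr_sum_autocorr : (\sum_j f j) ^+ 2 = \sum_k autocorr k.
Proof.
rewrite exchange_big /= expr2 mulr_suml; apply: eq_bigr => j _.
rewrite -mulr_sumr; congr (_ * _).
by rewrite -[LHS](sum_shift j); apply: eq_bigr => k _; rewrite addrC.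
Qed.

Lemma autocorr0 : sign_valued -> autocorr 0 = #|V|%:R.
Proof.
move=> sgn; rewrite /autocorr (eq_bigr (fun=> 1)) ?sumr_const // => j _.
by rewrite addr0; case: (sgn j) => ->; rewrite ?mulrNN mulr1.
Qed.

Lemma perfect_sqr_sum :
  sign_valued -> perfect -> (\sum_j f j) ^+ 2 = #|V|%:R.
Proof.
move=> sgn perf; rewrite sqr_sum_autocorr (bigD1 0) //= autocorr0 //.
by rewrite big1 ?addr0.
Qed.

End Autocorrelation.

Lemma perfect_card_square (V : finZmodType) (f : V -> int) :
  sign_valued f -> perfect f -> exists y : nat, #|V| = (y ^ 2)%N.
Proof.
move=> sgn perf; exists (absz (\sum_j f j)).
by have := perfect_sqr_sum sgn perf; move: (\sum_j f j) => x; nia.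
Qed.

Section Windows.

Variables (V : finZmodType) (u : V).

Definition isolated (T : eqType) (f : V -> T) : {set V} :=
  [set k | (f (k - u) != f k) && (f k != f (k + u))].

Definition alternation_starts (T : eqType) (f : V -> T) : {set V} :=
  [set k in isolated f | k - u \notin isolated f].

Lemma alternation_startsE (T : eqType) (f : V -> T) (j : V) :
  (j + u *+ 2 \in alternation_starts f) =
  [&& f j == f (j + u), f (j + u) != f (j + u *+ 2)
    & f (j + u *+ 2) != f (j + u *+ 3)].
Proof.
rewrite !inE [u *+ 3]mulrSr mulr2n !addrA !addrK.
by case: (f j == _); case: (_ == _); case: (_ == _).
Qed.

Variable f : V -> int.
Hypothesis sgn : sign_valued f.

Definition window_product (j : V) : int :=
  f j * f (j + u) * f (j + u *+ 2) * f (j + u *+ 3).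

Lemma card_isolated : uncorrelated f u 2 -> (4 * #|isolated f| = #|V|)%N.
Proof.
move=> unc; suff : 4 * #|isolated f|%:R = #|V|%:R :> int by lia.
rewrite -sum1_card natr_sum mulr_sumr big_mkcond -(sum_shift u) /=.
transitivity (\sum_j (1 - f (j + u *+ 0) * f (j + u *+ 1)
    - f (j + u *+ 1) * f (j + u *+ 2) + f (j + u *+ 0) * f (j + u *+ 2))).
  apply: eq_bigr => j _; rewrite inE addrK mulr0n addr0 mulr1n mulr2n addrA.
  by case: (sgn j) => ->; case: (sgn (j + u)) => ->;
     case: (sgn (j + u + u)) => ->.
rewrite !(big_split, sumrN) /= !(uncorrelated_shift unc) // sumr_const.
by rewrite !(addr0, subr0).
Qed.

Lemma card_alternation_starts : uncorrelated f u 3 ->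
  8 * #|alternation_starts f|%:R = #|V|%:R - \sum_j window_product j.
Proof.
move=> unc.
rewrite -sum1_card natr_sum mulr_sumr big_mkcond -(sum_shift (u *+ 2)) /=.
transitivity (\sum_j (1
    + f (j + u *+ 0) * f (j + u *+ 1) - f (j + u *+ 1) * f (j + u *+ 2)
    - f (j + u *+ 2) * f (j + u *+ 3) - f (j + u *+ 0) * f (j + u *+ 2)
    + f (j + u *+ 1) * f (j + u *+ 3) + f (j + u *+ 0) * f (j + u *+ 3)
    - window_product j)).
  apply: eq_bigr => j _.
  rewrite alternation_startsE /window_product mulr0n mulr1n addr0.
  by case: (sgn j) => ->; case: (sgn (j + u)) => ->;
     case: (sgn (j + u *+ 2)) => ->; case: (sgn (j + u *+ 3)) => ->.
rewrite !(big_split, sumrN) /= !(uncorrelated_shift unc) // sumr_const.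
by rewrite !(addr0, subr0).
Qed.

Lemma sum_window_product_le : autocorr f (u *+ 4) = 0 ->
  2 * \sum_j window_product j <= #|V|%:R.
Proof.
move=> unc4.
have sign_bound j :
    window_product j + window_product (j + u) - 1 <= f j * f (j + u *+ 4).
  rewrite /window_product -!addrA -!mulrS.
  by case: (sgn j) => ->; case: (sgn (j + u)) => ->;
     case: (sgn (j + u *+ 2)) => ->; case: (sgn (j + u *+ 3)) => ->;
     case: (sgn (j + u *+ 4)) => ->.
have := ler_sum (index_enum V) (fun j (_ : true) => sign_bound j).
rewrite -/(autocorr _ _) unc4 !big_split /= (sum_shift u window_product).
by rewrite sumr_const mulNrn; lra.
Qed.

Lemma leq_card_alternation_starts : uncorrelated f u 4 ->
  (#|V| <= 16 * #|alternation_starts f|)%N.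
Proof.
move=> unc; have := sum_window_product_le (unc 4 isT).
have unc3 : uncorrelated f u 3.
  by move=> k /andP[k_gt0 lek3]; apply: unc; rewrite k_gt0 ltnW.
by have := card_alternation_starts unc3; lia.
Qed.

End Windows.

Section AntiperiodicSequences.

Implicit Types (N : nat) (g : nat -> int).

Definition antiperiodic N g : Prop := forall i, g (i + N)%N = - g i.

Definition corr N g (a b : nat) : int :=
  \sum_(i < N) g (i + a)%N * g (i + b)%N.

Definition pair_sum g (i : nat) : int := g i + g i.+1.

Lemma pair_sum_antiperiodic N g :
  antiperiodic N g -> antiperiodic N (pair_sum g).
Proof. by move=> anti i; rewrite /pair_sum -addSn !anti opprD. Qed.

Lemma corr_pair_sum N g a b : corr N (pair_sum g) a b =
  corr N g a b + corr N g a b.+1 + (corr N g a.+1 b + corr N g a.+1 b.+1).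
Proof.
rewrite /corr -!big_split; apply: eq_bigr => i _ /=.
by rewrite /pair_sum mulrDl !mulrDr !addnS.
Qed.

Lemma iter_pair_sum_pow2 k g i :
  (iter (2 ^ k) pair_sum g i = g i + g (i + 2 ^ k)%N %[mod 2])%Z.
Proof.
elim: k g i => [|k IHk] g i; first by rewrite addn1.
rewrite expnS mul2n -addnn iterD addnA.
by have := IHk (iter (2 ^ k) pair_sum g) i; have := IHk g i;
   have := IHk g (i + 2 ^ k)%N; lia.
Qed.

Lemma corr01_odd N g : antiperiodic N g -> (forall i, ~~ (2 %| g i)%Z) ->
  (corr N g 0 1 = N%:Z - 2 %[mod 4])%Z.
Proof.
move=> anti odd_g; pose e i := (g i %/ 2)%Z.
have gE i : g i = 1 + 2 * e i by have := odd_g i; rewrite /e; lia.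
have telescope : \sum_(i < N) e i.+1 = \sum_(i < N) e i - 1 - 2 * e 0%N.
  have eN : e N = -1 - e 0%N by have := anti 0%N; rewrite add0n !gE; lia.
  have : \sum_(i < N) e i.+1 - \sum_(i < N) e i = e N - e 0%N.
    rewrite -sumrB -(big_mkord xpredT (fun i => e i.+1 - e i)).
    by rewrite telescope_sumr.
  by rewrite eN; lia.
suff -> : corr N g 0 1 = N%:Z + 2 * \sum_(i < N) e i + 2 * \sum_(i < N) e i.+1
    + 4 * \sum_(i < N) e i * e i.+1 by rewrite telescope; lia.
rewrite /corr !mulr_sumr -[X in X%:Z]card_ord -natz -sumr_const -!big_split.
by apply: eq_bigr => i _ /=; rewrite addn0 addn1 !gE; lia.
Qed.

Lemma antiperiodic_iter_even r N g :
    (N != 2 %[mod 4])%N -> antiperiodic N g ->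
    (forall a b, (4 %| corr N g a b)%Z) ->
    (forall i, (2 %| iter r pair_sum g i)%Z) ->
  forall i, (2 %| g i)%Z.
Proof.
move=> N4; elim: r g => [//|r IHr] g anti dvd_corr even_iter.
have even_pair_sum i : (2 %| g i + g i.+1)%Z.
  apply: (IHr (pair_sum g)); first exact: pair_sum_antiperiodic.
    by move=> a b; rewrite corr_pair_sum !rpredD.
  by move=> j; rewrite -iterSr.
have parity i : (2 %| g i)%Z = (2 %| g 0%N)%Z.
  by elim: i => // i <-; have := even_pair_sum i; lia.
move=> i; rewrite parity; apply: contraT => odd_g0.
have := corr01_odd anti (fun j => etrans (congr1 negb (parity j)) odd_g0).
by have := dvd_corr 0%N 1%N; lia.
Qed.

Lemma antiperiodic_pow2_even k g : (1 < k)%N -> antiperiodic (2 ^ k) g ->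
  (forall a b, (4 %| corr (2 ^ k) g a b)%Z) -> forall i, (2 %| g i)%Z.
Proof.
move=> k_gt1 anti dvd_corr; apply: (antiperiodic_iter_even (r := 2 ^ k)) => //.
  by rewrite -(subnK k_gt1) expnD; lia.
by move=> i; have := iter_pair_sum_pow2 k g i; rewrite anti; lia.
Qed.

Lemma corr_half_difference N (x : nat -> int) a b :
  (forall i, x (i + (N + N))%N = x i) ->
  corr N (fun i => x i - x (i + N)%N) a b =
  corr (N + N) x a b - corr (N + N) x a (N + b).
Proof.
move=> per; rewrite /corr !big_split_ord /= opprD -!sumrN -!big_split /=.
apply: eq_bigr => i _.
have -> : (N + i + a = i + a + N)%N by lia.
have -> : (N + i + b = i + b + N)%N by lia.
have -> : (i + (N + b) = i + b + N)%N by lia.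
have -> : (N + i + (N + b) = i + b + (N + N))%N by lia.
by rewrite per; lia.
Qed.

End AntiperiodicSequences.

Section PerfectCyclic.

Variables (p : nat) (f : 'I_p.+1 -> int).

Lemma inZpD (a b : nat) : inZp (a + b) = inZp a + inZp b :> 'I_p.+1.
Proof. by apply: val_inj; rewrite /= modnDm. Qed.

Lemma inZp_mul (k : nat) : inZp k = inZp 1 *+ k :> 'I_p.+1.
Proof. by rewrite Zp_mulrn; apply: val_inj; rewrite /= modnMml mul1n. Qed.

Lemma inZp_neq0 (k : nat) : (0 < k < p.+1)%N -> inZp k != 0 :> 'I_p.+1.
Proof. by case/andP=> k_gt0 ltkp; rewrite -val_eqE /= modn_small -?lt0n. Qed.

Lemma perfect_uncorrelated (m : nat) :
  (m <= p)%N -> perfect f -> uncorrelated f (inZp 1) m.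
Proof.
move=> lemp perf k /andP[k_gt0 lekm]; apply: perf.
by rewrite -inZp_mul inZp_neq0 // k_gt0 ltnS (leq_trans lekm).
Qed.

Lemma corr_inZp (a b : nat) :
  corr p.+1 (f \o inZp) a b = autocorr f (inZp b - inZp a).
Proof.
rewrite -autocorr_shift; apply: eq_bigr => i _.
by rewrite /= !inZpD !valZpK.
Qed.

Lemma perfect_dvd_corr (a b : nat) : sign_valued f -> perfect f ->
  (p.+1%:Z %| corr p.+1 (f \o inZp) a b)%Z.
Proof.
move=> sgn perf; rewrite corr_inZp.
have [->|/perf->] := eqVneq (inZp b - inZp a : 'I_p.+1) 0; last exact: dvdz0.
by rewrite autocorr0 // card_ord natz dvdzz.
Qed.

Lemma perfect_aperiodic (N : nat) : sign_valued f -> perfect f ->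
  (0 < N < p.+1)%N -> ~ (forall i, f (inZp i) = f (inZp (i + N))).
Proof.
move=> sgn perf /inZp_neq0/perf corrN0 perN.
suff : autocorr f (inZp N) = autocorr f 0.
  by rewrite corrN0 autocorr0 // card_ord; lia.
apply: eq_bigr => j _; rewrite addr0; congr (_ * _).
by have := perN j; rewrite inZpD valZpK.
Qed.

Lemma perfect_pow2_length (k : nat) :
  sign_valued f -> perfect f -> p.+1 = (2 ^ k)%N -> (k < 4)%N.
Proof.
move=> sgn perf lenE; rewrite ltnNge; apply/negP=> k_ge4.
pose x := f \o inZp; pose N := (2 ^ k.-1)%N.
have NN : p.+1 = (N + N)%N by rewrite lenE /N addnn -mul2n -expnS prednK; lia.
have N4 : (8 %| N)%N by rewrite -[8%N]/(2 ^ 3)%N dvdn_exp2l //; lia.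
have per i : x (i + (N + N))%N = x i.
  by rewrite /x -NN /=; congr f; apply: val_inj; rewrite /= modnDr.
pose d i := x i - x (i + N)%N; pose c i := (d i %/ 2)%Z.
have dE i : d i = 2 * c i.
  by rewrite /c /d /x /=; case: (sgn (inZp i)) => ->;
     case: (sgn (inZp (i + N))) => ->.
have anti_c : antiperiodic N c.
  by move=> i; have := dE i; have := dE (i + N)%N; rewrite /d -addnA per; lia.
have dvd_corr_c a b : (4 %| corr N c a b)%Z.
  have : (p.+1%:Z %| corr N d a b)%Z.
    by rewrite corr_half_difference // -NN rpredB // perfect_dvd_corr.
  have -> : corr N d a b = 4 * corr N c a b.
    by rewrite /corr mulr_sumr; apply: eq_bigr => i _; rewrite !dE; lia.
  by rewrite NN; lia.
apply: (perfect_aperiodic sgn perf (N := N)); first by lia.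
move=> i; have := antiperiodic_pow2_even _ anti_c dvd_corr_c i.
move=> /(_ ltac:(lia)); have := dE i; rewrite /d /x /=.
by case: (sgn (inZp i)) => ->; case: (sgn (inZp (i + N))) => ->; lia.
Qed.

End PerfectCyclic.

Section Consecutive.

Variables (T : finType) (f : T -> T).

Lemma consecutive_set1 (x : T) : consecutive f [set x].
Proof.
rewrite /consecutive -card_gt0 cards1; apply/existsP; exists x.
by apply/eqP/setP=> y; rewrite !inE.
Qed.

Lemma consecutive_set2 (x : T) : consecutive f [set x; f x].
Proof.
have [<-|neq] := eqVneq x (f x); first by rewrite setUid consecutive_set1.
rewrite /consecutive -card_gt0 cards2 neq; apply/existsP; exists x.
by apply/eqP/setP=> y; rewrite !inE.
Qed.

Lemma consecutive_neighbour (A : {set T}) (x : T) :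
  consecutive f A -> x \in A -> A != [set x] ->
  (exists2 y, y \in A & f y = x) \/ f x \in A.
Proof.
case/andP=> _ /existsP[a /eqP defA] xA A_neq.
have iterA i : (i < #|A|)%N -> iter i f a \in A.
  by move=> lti; rewrite defA inE; apply/trajectP; exists i.
move: (xA); rewrite {1}defA inE => /trajectP[[|i] lti defx]; last first.
  by left; exists (iter i f a) => //; apply/iterA/ltnW.
right; rewrite defx; apply: (iterA 1%N); rewrite ltnNge.
by apply: contra A_neq => le1; rewrite eq_sym eqEcard sub1set xA cards1.
Qed.

Lemma consecutive_source_inj (A : {set T}) (x y : T) :
  consecutive f A -> x \in A -> y \in A ->
  {in A, forall z, f z != x} -> {in A, forall z, f z != y} -> x = y.
Proof.
case/andP=> _ /existsP[a /eqP defA].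
suff head z : z \in A -> {in A, forall t, f t != z} -> z = a.
  by move=> xA yA /(head x xA)-> /(head y yA)->.
rewrite {1}defA inE => /trajectP[[//|i] lti ->] /(_ (iter i f a)).
rewrite eqxx defA inE => /(_ _)/negP[] //.
by apply/trajectP; exists i; first exact: ltnW.
Qed.

End Consecutive.

Lemma leq_card_maxset (T : finType) (P : pred {set T}) (A : {set T}) :
  {in A, forall x, P [set x]} ->
  (forall U, P U -> {in A &, forall x y, x \in U -> y \in U -> x = y}) ->
  (#|A| <= #|[set U | maxset P U]|)%N.
Proof.
move=> P1 inj; pose S x := odflt set0 [pick U | maxset P U && (x \in U)].
have SP x : x \in A -> maxset P (S x) /\ x \in S x.
  move=> /P1/maxset_exists[U maxU]; rewrite sub1set /S => xU.
  by case: pickP => [V /andP[]//|/(_ U)]; rewrite maxU xU.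
rewrite -(card_in_imset (f := S)) => [|x y xA yA eqS].
  apply/subset_leq_card/subsetP=> _ /imsetP[x xA ->].
  by rewrite inE; have [] := SP x xA.
have [maxS xS] := SP x xA; have [_ yS] := SP y yA.
by apply: (inj (S x)); rewrite ?(maxsetp maxS) // eqS.
Qed.

Section Blocks.

Variables (p : nat) (h : 'rV[int]_p.+1).
Hypothesis p_gt0 : (0 < p)%N.

Let u : 'I_p.+1 := inZp 1.

Lemma ordS_add (j : 'I_p.+1) : ordS j = j + u.
Proof. by apply: val_inj; rewrite /= modnDmr addn1. Qed.

Lemma ordS_neq (j : 'I_p.+1) : ordS j != j.
Proof. by rewrite ordS_add -subr_eq0 addrC addKr inZp_neq0. Qed.

Lemma constant_onP (B : {set 'I_p.+1}) :
  reflect {in B &, forall x y, h ord0 x = h ord0 y} (constant_on h B).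
Proof.
apply: (iffP 'forall_implyP) => [const x y xB yB | const x xB].
  by move/(_ _ xB)/'forall_implyP/(_ _ yB)/eqP: const.
by apply/'forall_implyP=> y yB; apply/eqP/const.
Qed.

Lemma is_block_set1 (k : 'I_p.+1) :
  is_block h [set k] = (k \in isolated u (h ord0)).
Proof.
rewrite inE; apply/idP/andP=> [/maxsetP[_ kmax] | [hl hr]].
  suff adj x : k \in [set x; ordS x] -> h ord0 x != h ord0 (ordS x).
    split; last by rewrite -ordS_add; apply: adj; rewrite set21.
    by have := adj (k - u); rewrite ordS_add subrK; apply; rewrite set22.
  move=> kx; apply/eqP=> eqh; have := cards1 k.
  rewrite -(kmax [set x; ordS x]) ?cards2 1?eq_sym ?ordS_neq ?sub1set //.
  rewrite consecutive_set2; apply/constant_onP => y z.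
  by move=> /set2P[]-> /set2P[]->.
apply/maxsetP; split.
  by rewrite consecutive_set1; apply/constant_onP => x y /set1P-> /set1P->.
move=> C /andP[consC /constant_onP constC]; rewrite sub1set => kC.
apply/eqP; apply: contraT => /(consecutive_neighbour consC kC)[[y yC defk]|].
  by move: hl; rewrite -{1}defk ordS_add addrK (constC y k) ?eqxx.
by rewrite ordS_add => /(constC k _ kC) eqh; rewrite eqh eqxx in hr.
Qed.

Lemma next_block_set1 (x k : 'I_p.+1) :
  next_block h [set x] = [set k] -> k = x + u.
Proof.
rewrite /next_block; case: pickP => [y|/(_ x)]; last first.
  by rewrite !inE eqxx ordS_neq.
rewrite inE => /andP[/eqP-> _]; rewrite ordS_add /pblock.
case: pickP => [B /andP[_ /= xB] defB|_ /esym/eqP]; last first.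
  by rewrite -subset0 sub1set inE.
by apply/esym/set1P; rewrite -defB.
Qed.

Definition unit_blocks : {set {set 'I_p.+1}} :=
  [set B in blocks h | #|B| == 1%N].

Lemma unit_blocksE : unit_blocks = set1 @: isolated u (h ord0).
Proof.
apply/setP=> B; rewrite !inE; apply/andP/imsetP.
  by case=> blockB /cards1P[k defB]; exists k; rewrite // -is_block_set1 -defB.
by case=> k kI ->; rewrite is_block_set1 kI cards1.
Qed.

Lemma leq_alternation_starts_alpha1 :
  (#|alternation_starts u (h ord0)| <= alpha1 h)%N.
Proof.
rewrite -(card_imset (mem (alternation_starts u (h ord0))) set1_inj).
apply: leq_card_maxset => [_ /imsetP[k kA ->] | U /andP[consU /subsetP unitU]].
  rewrite consecutive_set1 sub1set -/unit_blocks unit_blocksE imset_f //.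
  by move: kA; rewrite inE => /andP[].
have source k : k \in alternation_starts u (h ord0) ->
    {in U, forall B, next_block h B != [set k]}.
  rewrite inE => /andP[_ /negP prev] B /unitU.
  rewrite -/unit_blocks unit_blocksE => /imsetP[x xI ->].
  by apply/eqP=> /next_block_set1 defk; apply: prev; rewrite defk addrK.
move=> _ _ /imsetP[k kA ->] /imsetP[l lA ->] kU lU.
by apply: (consecutive_source_inj consU kU lU); apply: source.
Qed.

Lemma alpha1_le1 : (#|isolated u (h ord0)| <= 1)%N -> (alpha1 h <= 1)%N.
Proof.
rewrite -(card_imset (mem (isolated u (h ord0))) set1_inj) -unit_blocksE.
move=> unit1; rewrite -(cards1 unit_blocks); apply: subset_leq_card.
apply/subsetP=> S; rewrite !inE => /maxsetp/andP[/andP[S_neq0 _] subS].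
by rewrite eqEcard subS (leq_trans unit1) // card_gt0.
Qed.

Hypotheses (sgn : sign_valued (h ord0)) (perf : perfect (h ord0)).

Lemma perfect_alpha1_le1 : p.+1 = 4%N -> (alpha1 h <= 1)%N.
Proof.
move=> len4; apply: alpha1_le1.
have := card_isolated sgn (perfect_uncorrelated (m := 2) _ perf).
by rewrite card_ord => /(_ ltac:(lia)); rewrite -/u; lia.
Qed.

Lemma perfect_length_le_alpha1 : (4 < p.+1)%N -> (p.+1 <= 16 * alpha1 h)%N.
Proof.
move=> lt4p; rewrite -[leqLHS]card_ord.
have unc := perfect_uncorrelated (m := 4) lt4p perf.
apply: leq_trans (leq_card_alternation_starts sgn unc) _.
by rewrite leq_mul2l leq_alternation_starts_alpha1.
Qed.

End Blocks.

Lemma perfect_defining_row (p : nat) (H : 'M[int]_p.+1) :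
  hadamard H -> circulant H -> perfect (defining_row H ord0).
Proof.
move=> [_ orth] circ k k_neq0; rewrite -[RHS](orth 0 (- k)); last first.
  by rewrite eq_sym oppr_eq0.
by apply: eq_bigr => j _; rewrite !circ opprK subr0.
Qed.

Theorem theorem2 (p m : nat) (H : 'M[int]_p.+1)
    (hn : p.+1 = (4 * m)%N) (hn1 : (1 < p.+1)%N)
    (hH : pm1_mx H) (halpha : alpha1 (defining_row H) = 2%N) :
  ~ (hadamard H /\ circulant H).
Proof.
case=> hadH circH; have perf := perfect_defining_row hadH circH.
have sgn : sign_valued (defining_row H ord0).
  by move=> j; rewrite mxE; apply: hH.
have m_neq1 : m != 1%N.
  apply/eqP=> m1; have := perfect_alpha1_le1 hn1 sgn perf.
  by rewrite halpha hn m1 => /(_ erefl).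
have m_le8 : (m <= 8)%N.
  have := perfect_length_le_alpha1 hn1 sgn perf.
  by rewrite halpha; lia.
have m4 : m = 4%N.
  have [y] := perfect_card_square sgn perf; rewrite card_ord hn => sqr_y.
  have y_le5 : (y <= 5)%N by nia.
  by move: y_le5 sqr_y; do 6?[case: y => [|y]]; lia.
suff : (4 < 4)%N by [].
by apply: (perfect_pow2_length sgn perf); rewrite hn m4.
Qed.
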